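(* Let $\alpha_0,\alpha_1$ be complex parameters with $\alpha_0+\alpha_1=0$. The system of partial differential equations in the variables $t_1,t_2,t_3$ $$dq_m=\sum_{i=1}^{3}\frac{\partial K_i}{\partial p_m}\,dt_i,\qquad dp_m=-\sum_{i=1}^{3}\frac{\partial K_i}{\partial q_m}\,dt_i\qquad(m=1,2),$$ with the polynomial Hamiltonians $K_1,K_2,K_3$ given in the context, admits the affine Weyl group of type $A_1^{(1)}$ as a group of Bäcklund transformations, whose generators $s_0,s_1$ are defined as follows: with $( * ):=(q_1,p_1,q_2,p_2,t_1,t_2,t_3;\alpha_0,\alpha_1)$ and $f_1:=q_1+p_1^2+p_2^2$, $$s_0:( * )\mapsto\Big(q_1,\;p_1-\frac{\alpha_0}{q_1+q_2^2},\;q_2,\;p_2-\frac{2\alpha_0q_2}{q_1+q_2^2},\;t_1,t_2,t_3;\;-\alpha_0,\;\alpha_1+2\alpha_0\Big),$$ $$s_1:( * )\mapsto\Big(q_1+\frac{2\alpha_1p_1}{f_1}-\frac{\alpha_1^2}{f_1^2},\;p_1-\frac{\alpha_1}{f_1},\;q_2+\frac{2\alpha_1p_2}{f_1},\;p_2,\;t_1,t_2,t_3;\;\alpha_0+2\alpha_1,\;-\alpha_1\Big).$$ That is, each $s_i$ is a Bäcklund transformation of the system, and $s_0,s_1$ satisfy the defining relations of the affine Weyl group of type $A_1^{(1)}$.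
   Context: The Hamiltonians are $$K_1=q_1p_1^2+q_1^2-\alpha_0p_1+\tfrac14q_2^2-\tfrac14p_2^2+p_1q_2p_2,$$ $$K_2=q_2^2p_2^2-\tfrac14q_2^2+\tfrac14p_2^2-2\alpha_0q_2p_2+q_1q_2^2+q_1p_2^2-p_1q_2p_2+p_1^2q_2^2,$$ $$\begin{aligned}K_3=&\tfrac12q_1^2p_1^4+q_1^3p_1^2+\tfrac12q_1^4-\alpha_0q_1p_1^3+\alpha_1q_1^2p_1+\tfrac12\alpha_0^2p_1^2+\tfrac1{32}q_2^4+\tfrac1{32}p_2^4-\tfrac1{16}q_2^2p_2^2+q_1p_1^3q_2p_2\\&+\tfrac12p_1^2q_2^2p_2^2-\tfrac14q_1p_1^2p_2^2-\tfrac14p_1q_2p_2^3+q_1^2p_1q_2p_2+\tfrac14q_1p_1^2q_2^2+\tfrac14p_1q_2^3p_2-\alpha_0p_1^2q_2p_2\\&+\tfrac14\alpha_0p_1p_2^2+\tfrac14\alpha_1p_1q_2^2+\tfrac14q_1^2q_2^2-\tfrac14q_1^2p_2^2.\end{aligned}$$ A Bäcklund transformation here is a birational transformation of $(q_1,p_1,q_2,p_2)$, together with a map on the parameters, such that if $(q_1,p_1,q_2,p_2)$ satisfies the system with parameters $(\alpha_0,\alpha_1)$ then the transformed variables satisfy the same system with the transformed parameters. The $s_i$ are composed as automorphisms of the field of rational functions in $q_1,p_1,q_2,p_2,t_1,t_2,t_3,\alpha_0,\alpha_1$ (modulo $\alpha_0+\alpha_1=0$). The affine Weyl group of type $A_1^{(1)}$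 is $\langle s_0,s_1\mid s_0^2=s_1^2=1\rangle$. *)

(* Defs.v *)
(* MathComp / MathComp-Analysis *)
From HB Require Import structures.
From mathcomp Require Import all_boot all_order all_algebra.
From mathcomp Require Import fraction complex.
From mathcomp Require mpoly.
From mathcomp Require Import all_classical all_reals all_analysis.

Set Implicit Arguments.
Unset Strict Implicit.
Unset Printing Implicit Defensive.

Import Order.TTheory GRing.Theory Num.Theory.
(* The notations of mpoly clash with those of mathcomp-analysis. *)
Import -(notations) mpoly.
Import numFieldNormedType.Exports.

Local Open Scope classical_set_scope.
Local Open Scope ring_scope.

(* The complex numbers; the type annotation makes R[i] carry the topology that
   mathcomp-analysis puts on every numFieldType, so that differentials below
   are C-linear. *)
Definition Cplx (R : realType) : numFieldType := complex R.

(* Phase-space coordinates are listed in the order q1, p1, q2, p2. *)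
Definition iq1 : 'I_4 := @Ordinal 4 0 isT.
Definition ip1 : 'I_4 := @Ordinal 4 1 isT.
Definition iq2 : 'I_4 := @Ordinal 4 2 isT.
Definition ip2 : 'I_4 := @Ordinal 4 3 isT.

Definition phase_var (R : realType) (k : 'I_4) : mpoly 4 (Cplx R) :=
  mpolyX (Cplx R) (mnm1 k).

Definition K1 (R : realType) (a0 a1 : Cplx R) : mpoly 4 (Cplx R) :=
  let q1 := phase_var R iq1 in let p1 := phase_var R ip1 in
  let q2 := phase_var R iq2 in let p2 := phase_var R ip2 in
  q1 * p1 ^+ 2 + q1 ^+ 2 - a0 *: p1 + (1 / 4) *: q2 ^+ 2 - (1 / 4) *: p2 ^+ 2
  + p1 * q2 * p2.

Definition K2 (R : realType) (a0 a1 : Cplx R) : mpoly 4 (Cplx R) :=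
  let q1 := phase_var R iq1 in let p1 := phase_var R ip1 in
  let q2 := phase_var R iq2 in let p2 := phase_var R ip2 in
  q2 ^+ 2 * p2 ^+ 2 - (1 / 4) *: q2 ^+ 2 + (1 / 4) *: p2 ^+ 2
  - (2 * a0) *: (q2 * p2) + q1 * q2 ^+ 2 + q1 * p2 ^+ 2 - p1 * q2 * p2
  + p1 ^+ 2 * q2 ^+ 2.

Definition K3 (R : realType) (a0 a1 : Cplx R) : mpoly 4 (Cplx R) :=
  let q1 := phase_var R iq1 in let p1 := phase_var R ip1 in
  let q2 := phase_var R iq2 in let p2 := phase_var R ip2 in
  (1 / 2) *: (q1 ^+ 2 * p1 ^+ 4) + q1 ^+ 3 * p1 ^+ 2 + (1 / 2) *: q1 ^+ 4
  - a0 *: (q1 * p1 ^+ 3) + a1 *: (q1 ^+ 2 * p1)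
  + (1 / 2 * a0 ^+ 2) *: p1 ^+ 2
  + (1 / 32) *: q2 ^+ 4 + (1 / 32) *: p2 ^+ 4
  - (1 / 16) *: (q2 ^+ 2 * p2 ^+ 2) + q1 * p1 ^+ 3 * q2 * p2
  + (1 / 2) *: (p1 ^+ 2 * q2 ^+ 2 * p2 ^+ 2)
  - (1 / 4) *: (q1 * p1 ^+ 2 * p2 ^+ 2) - (1 / 4) *: (p1 * q2 * p2 ^+ 3)
  + q1 ^+ 2 * p1 * q2 * p2 + (1 / 4) *: (q1 * p1 ^+ 2 * q2 ^+ 2)
  + (1 / 4) *: (p1 * q2 ^+ 3 * p2) - a0 *: (p1 ^+ 2 * q2 * p2)
  + (1 / 4 * a0) *: (p1 * p2 ^+ 2) + (1 / 4 * a1) *: (p1 * q2 ^+ 2)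
  + (1 / 4) *: (q1 ^+ 2 * q2 ^+ 2) - (1 / 4) *: (q1 ^+ 2 * p2 ^+ 2).

Definition hamiltonian (R : realType) (a0 a1 : Cplx R) (i : 'I_3) :
    mpoly 4 (Cplx R) :=
  tnth [tuple K1 a0 a1; K2 a0 a1; K3 a0 a1] i.

(* The 1-form \sum_i (dK_i / dx_k)(v) dt_i, as a function of the tangent vector
   h = (dt_1, dt_2, dt_3). *)
Definition ham_form (R : realType) (a0 a1 : Cplx R) (k : 'I_4)
    (v : 'I_4 -> Cplx R) (h : 'rV[Cplx R]_3) : Cplx R :=
  \sum_(i < 3) meval v (mderiv k (hamiltonian a0 a1 i)) * h 0 i.

(* x = (q1, p1, q2, p2) is a holomorphic solution on U: the total
   (C-linear) differentials are the ones prescribed by the Pfaffian system. *)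
Definition solution (R : realType) (a0 a1 : Cplx R) (U : set 'rV[Cplx R]_3)
    (x : 'I_4 -> 'rV[Cplx R]_3 -> Cplx R) : Prop :=
  forall t, U t ->
    [/\ is_diff t (x iq1) (ham_form a0 a1 ip1 (x ^~ t)),
        is_diff t (x ip1) (fun h => - ham_form a0 a1 iq1 (x ^~ t) h),
        is_diff t (x iq2) (ham_form a0 a1 ip2 (x ^~ t))
      & is_diff t (x ip2) (fun h => - ham_form a0 a1 iq2 (x ^~ t) h)].

(* The field of rational functions in q1, p1, q2, p2, t1, t2, t3, alpha0, alpha1
   modulo alpha0 + alpha1 = 0: alpha1 is eliminated, leaving 8 independent
   variables q1, p1, q2, p2, t1, t2, t3, alpha0. *)
Definition ratfun (R : realType) : fieldType := {fraction (mpoly 8 (Cplx R))}.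

Definition rat_poly (R : realType) (p : mpoly 8 (Cplx R)) : ratfun R :=
  FracField.tofrac p.
Definition rat_const (R : realType) (c : Cplx R) : ratfun R :=
  rat_poly (mpolyC 8 c).
Definition rat_var (R : realType) (k : 'I_8) : ratfun R :=
  rat_poly (mpolyX (Cplx R) (mnm1 k)).

Definition Fphase (R : realType) (k : 'I_4) : ratfun R :=
  rat_var R (widen_ord (isT : (4 <= 8)%N) k).
Definition Fq1 (R : realType) : ratfun R := Fphase R iq1.
Definition Fp1 (R : realType) : ratfun R := Fphase R ip1.
Definition Fq2 (R : realType) : ratfun R := Fphase R iq2.
Definition Fp2 (R : realType) : ratfun R := Fphase R ip2.
Definition Ft1 (R : realType) : ratfun R := rat_var R (@Ordinal 8 4 isT).
Definition Ft2 (R : realType) : ratfun R := rat_var R (@Ordinal 8 5 isT).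
Definition Ft3 (R : realType) : ratfun R := rat_var R (@Ordinal 8 6 isT).
Definition Falpha0 (R : realType) : ratfun R := rat_var R (@Ordinal 8 7 isT).
Definition Falpha1 (R : realType) : ratfun R := - Falpha0 R.

(* f is regular at z, with value v there: some fraction representing f has a
   denominator that does not vanish at z. *)
Definition has_value (R : realType) (f : ratfun R) (z : 'I_8 -> Cplx R)
    (v : Cplx R) : Prop :=
  exists n d : mpoly 8 (Cplx R),
    [/\ meval z d != 0, f = rat_poly n / rat_poly d
      & v = meval z n / meval z d].

Definition point (R : realType) (v : 'I_4 -> Cplx R) (t : 'rV[Cplx R]_3)
    (a0 : Cplx R) (k : 'I_8) : Cplx R :=
  tnth [tuple v iq1; v ip1; v iq2; v ip2;
              t 0 (@Ordinal 3 0 isT); t 0 (@Ordinal 3 1 isT);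
              t 0 (@Ordinal 3 2 isT); a0] k.

(* s is given by its pullback action on rational functions; b is the map on
   the parameters.  A solution x is transformed wherever s is defined along
   it, and no particular choice of U is made, so U may be any open set on which
   x solves the system and avoids the indeterminacy locus of s. *)
Definition Baecklund (R : realType) (s : {rmorphism ratfun R -> ratfun R})
    (b : Cplx R * Cplx R -> Cplx R * Cplx R) : Prop :=
  [/\ bijective s,
      forall c : Cplx R, s (rat_const c) = rat_const c,
      [/\ s (Ft1 R) = Ft1 R, s (Ft2 R) = Ft2 R & s (Ft3 R) = Ft3 R],
      forall (a0 a1 : Cplx R) (v : 'I_4 -> Cplx R) (t : 'rV[Cplx R]_3)
          (c : Cplx R), a0 + a1 = 0 ->
        (has_value (s (Falpha0 R)) (point v t a0) c -> c = (b (a0, a1)).1) /\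
        (has_value (s (Falpha1 R)) (point v t a0) c -> c = (b (a0, a1)).2)
    & forall (a0 a1 : Cplx R) (U : set 'rV[Cplx R]_3)
          (x y : 'I_4 -> 'rV[Cplx R]_3 -> Cplx R),
        a0 + a1 = 0 -> open U -> solution a0 a1 U x ->
        (forall (t : 'rV[Cplx R]_3) (k : 'I_4), U t ->
           has_value (s (Fphase R k)) (point (x ^~ t) t a0) (y k t)) ->
        solution (b (a0, a1)).1 (b (a0, a1)).2 U y].

Definition s0_action (R : realType) (s : ratfun R -> ratfun R) : Prop :=
  let q1 := Fq1 R in let p1 := Fp1 R in
  let q2 := Fq2 R in let p2 := Fp2 R in
  let alpha0 := Falpha0 R in let alpha1 := Falpha1 R in
  [/\ [/\ s q1 = q1, s p1 = p1 - alpha0 / (q1 + q2 ^+ 2),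
          s q2 = q2 & s p2 = p2 - 2 * alpha0 * q2 / (q1 + q2 ^+ 2)],
      [/\ s (Ft1 R) = Ft1 R, s (Ft2 R) = Ft2 R & s (Ft3 R) = Ft3 R]
    & s alpha0 = - alpha0 /\ s alpha1 = alpha1 + 2 * alpha0].

Definition s1_action (R : realType) (s : ratfun R -> ratfun R) : Prop :=
  let q1 := Fq1 R in let p1 := Fp1 R in
  let q2 := Fq2 R in let p2 := Fp2 R in
  let alpha0 := Falpha0 R in let alpha1 := Falpha1 R in
  let f1 := q1 + p1 ^+ 2 + p2 ^+ 2 in
  [/\ [/\ s q1 = q1 + 2 * alpha1 * p1 / f1 - alpha1 ^+ 2 / f1 ^+ 2,
          s p1 = p1 - alpha1 / f1,
          s q2 = q2 + 2 * alpha1 * p2 / f1 & s p2 = p2],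
      [/\ s (Ft1 R) = Ft1 R, s (Ft2 R) = Ft2 R & s (Ft3 R) = Ft3 R]
    & s alpha0 = alpha0 + 2 * alpha1 /\ s alpha1 = - alpha1].

Definition s0_param (R : realType) (a : Cplx R * Cplx R) : Cplx R * Cplx R :=
  (- a.1, a.2 + 2 * a.1).
Definition s1_param (R : realType) (a : Cplx R * Cplx R) : Cplx R * Cplx R :=
  (a.1 + 2 * a.2, - a.2).

(* Main.v *)
(* Put f = q1 + q2^2 for s_0 and f = q1 + p1^2 + p2^2 for s_1.  Then s_i is
   polynomial in the phase variables and u = alpha_i / f.  Since s_i fixes f and
   negates alpha_i, it is an involution, and it maps polynomials to fractions
   whose denominators are powers of f; this makes the substitution injective, so
   that it extends to rational functions.  The transformed variables of a
   solution are defined exactly where f does not vanish, and there, once alpha_i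
   is replaced by u f, the transformed equations are identities between rational
   functions of u and the phase variables, with denominator f. *)
From HB Require Import structures.
Require Import Defs.
From mathcomp Require Import all_boot all_order all_algebra.
From mathcomp Require Import fraction ring.
From mathcomp Require mpoly.
From mathcomp Require Import all_classical all_reals all_analysis.

Import GRing.Theory Num.Theory.
Import -(notations) mpoly.
Import numFieldNormedType.Exports.

Set Implicit Arguments.
Unset Strict Implicit.
Unset Printing Implicit Defensive.

Local Open Scope classical_set_scope.
Local Open Scope ring_scope.

Local Notation tofrac := (@FracField.tofrac _).

(** * Fraction fields and substitutions that extend to them *)

Lemma fractionP (D : idomainType) (x : {fraction D}) :
  exists n d : D, d != 0 /\ x = tofrac n / tofrac d.
Proof.
elim/quotW: x => r; exists (frac r).1, (frac r).2.
have d0 := denom_ratioP r; split=> //.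
apply: (canRL (mulfK _)); first by rewrite tofrac_eq0.
rewrite !piE /=; apply/eqmodP; rewrite /= FracField.equivfE.
by rewrite /FracField.mulf !numden_Ratio ?oner_eq0 ?mulr1 ?mul1r 1?mulrC.
Qed.

(** Injectivity keeps the images of denominators nonzero, so [phi n / phi d] makes sense;
    cross-multiplication shows that it does not depend on the chosen fraction. *)
Lemma fraction_lift (D : idomainType) (F : fieldType)
    (phi : {rmorphism D -> F}) :
  injective phi ->
  exists psi : {rmorphism {fraction D} -> F},
    forall p, psi (tofrac p) = phi p.
Proof.
move=> phi_inj.
have phi0 p : p != 0 -> phi p != 0.
  by move=> p0; rewrite -(rmorph0 phi) (inj_eq phi_inj).
have [nd ndP] : {nd : {fraction D} -> D * D & forall x, (nd x).2 != 0 /\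
    x = tofrac (nd x).1 / tofrac (nd x).2}.
  apply: (@choice _ _ (fun x (nd : D * D) => nd.2 != 0 /\
    x = tofrac nd.1 / tofrac nd.2)) => x.
  by have [n [d ?]] := fractionP x; exists (n, d).
pose psi x := phi (nd x).1 / phi (nd x).2.
have psiE n d : d != 0 ->
    psi (tofrac n / tofrac d) = phi n / phi d.
  move=> d0; rewrite /psi; have [e0] := ndP (tofrac n / tofrac d).
  move: (nd _) e0 => [m e] /= e0 /eqP.
  rewrite eqr_div ?tofrac_eq0 // -!tofracM tofrac_eq => /eqP E.
  by apply/eqP; rewrite eqr_div ?phi0 // -!rmorphM E.
have psi_zmod : zmod_morphism psi.
  move=> x y; have [n [d [d0 ->]]] := fractionP x.
  have [m [e [e0 ->]]] := fractionP y.
  rewrite -mulNr -tofracN addf_div ?tofrac_eq0 // -!tofracM -tofracD.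
  rewrite !psiE ?mulf_neq0 // rmorphD !rmorphM rmorphN -addf_div ?phi0 //.
  by rewrite mulNr.
have psi_monoid : monoid_morphism psi.
  split=> [|x y].
    have := psiE 1 1 (oner_neq0 _).
    by rewrite !rmorph1 !divr1.
  have [n [d [d0 ->]]] := fractionP x.
  have [m [e [e0 ->]]] := fractionP y.
  rewrite mulf_div -!tofracM !psiE ?mulf_neq0 // !rmorphM.
  by rewrite mulf_div.
exists (HB.pack_for {rmorphism {fraction D} -> F} psi
  (GRing.isZmodMorphism.Build _ _ psi psi_zmod)
  (GRing.isMonoidMorphism.Build _ _ psi psi_monoid)) => p /=.
by have := psiE p 1 (oner_neq0 _); rewrite !rmorph1 !divr1.
Qed.

Lemma mpoly_subring_ind (n : nat) (K : nzRingType) (P : mpoly n K -> Prop) :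
  (forall c, P (mpolyC n c)) -> (forall k, P (mpolyX K (mnm1 k))) ->
  (forall p q, P p -> P q -> P (p + q)) ->
  (forall p q, P p -> P q -> P (p * q)) -> forall p, P p.
Proof.
move=> PC PX PD PM; apply: mpolyind => [|c m p _ _ Pp].
  by rewrite -mpolyC0.
apply: PD => //; rewrite -mul_mpolyC; apply: (PM) => //.
rewrite mpolyXE_id; apply: big_ind => [|//|i _]; first by rewrite -mpolyC1.
by elim: (m i) => [|e IHe]; rewrite ?expr0 -?mpolyC1 // exprS; apply: PM.
Qed.

(* If a polynomial f is fixed by the substitution g and the substitution of g
   undoes itself on the variables, up to powers of f, then for every p there
   are N and P with p(g) f^N = P and P(g) = f^N p; hence p(g) = 0 only if
   p = 0, so that the substitution extends to the fraction field. *)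
Lemma involutive_substitution (n : nat) (K : idomainType)
    (g : 'I_n -> {fraction (mpoly n K)}) (f : mpoly n K) :
  let phi : mpoly n K -> {fraction (mpoly n K)} :=
    mmap (tofrac \o @mpolyC n K) g in
  f != 0 -> phi f = tofrac f ->
  (forall k, exists N P, g k * tofrac f ^+ N = tofrac P /\
     phi P = tofrac (f ^+ N * mpolyX K (mnm1 k))) ->
  exists s : {rmorphism {fraction (mpoly n K)} -> {fraction (mpoly n K)}},
    [/\ forall p, s (tofrac p) = phi p, s \o s =1 id,
        forall c, s (tofrac (mpolyC n c)) = tofrac (mpolyC n c)
      & forall k, s (tofrac (mpolyX K (mnm1 k))) = g k].
Proof.
move=> phi f0 phif gP.
pose phiM : {rmorphism mpoly n K -> {fraction (mpoly n K)}} := phi.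
have phiD p q : phi (p + q) = phi p + phi q by apply: (rmorphD phiM).
have phiMul p q : phi (p * q) = phi p * phi q by apply: (rmorphM phiM).
have phiXn p e : phi (p ^+ e) = phi p ^+ e by apply: (rmorphXn phiM).
have phiC c : phi (mpolyC n c) = tofrac (mpolyC n c) by apply: mmapC.
have phiX k : phi (mpolyX K (mnm1 k)) = g k by rewrite /phi mmapX mmap1U.
have undo p : exists N P, phi p * tofrac f ^+ N = tofrac P /\
    phi P = tofrac (f ^+ N * p).
  elim/mpoly_subring_ind: p => [c|k|p q|p q].
  - by exists 0%N, (mpolyC n c); rewrite !expr0 mulr1 mul1r phiC.
  - by rewrite phiX; apply: gP.
  - move=> [N [P [pP Pp]]] [M [Q [qQ Qq]]].
    (* Both summands are brought over the denominator f^(N+M); the extra powers of f are harmless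
       since [phi] fixes f. *)
    exists (N + M)%N, (P * f ^+ M + Q * f ^+ N); split.
      rewrite phiD exprD tofracD !tofracM !tofracXn -pP -qQ.
      by move: (phi p) (phi q) (tofrac f ^+ N) (tofrac f ^+ M) => a b c d; ring.
    rewrite phiD !phiMul !phiXn phif Pp Qq -!tofracXn -!tofracM -tofracD.
    by congr (tofrac _); rewrite exprD; ring.
  - move=> [N [P [pP Pp]]] [M [Q [qQ Qq]]].
    exists (N + M)%N, (P * Q); split.
      rewrite phiMul exprD tofracM -pP -qQ.
      by move: (phi p) (phi q) (tofrac f ^+ N) (tofrac f ^+ M) => a b c d; ring.
    rewrite phiMul Pp Qq -tofracM.
    by congr (tofrac _); rewrite exprD; ring.
have phi_inj : injective phiM.
  apply/raddf_inj => p phip; have [N [P []]] := undo p.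
  rewrite [phi p]phip mul0r => /esym/eqP; rewrite tofrac_eq0 => /eqP ->.
  rewrite [phi 0](rmorph0 phiM) => /esym/eqP.
  rewrite tofrac_eq0 mulf_eq0 expf_eq0 (negPf f0) andbF.
  by move/eqP.
have [s sE] := fraction_lift phi_inj; exists s.
split=> [//|x|c|k] /=; last 2 first.
- by rewrite sE; apply: phiC.
- by rewrite sE; apply: phiX.
have ss p : s (s (tofrac p)) = tofrac p.
  have [N [P [pP Pp]]] := undo p.
  have fN0 : tofrac f ^+ N != 0 by rewrite expf_neq0 // tofrac_eq0.
  (* Since s fixes f, s(s(p)) f^N = s(s(p) f^N) = s(P) = f^N p. *)
  apply: (mulIf fN0); rewrite [s (tofrac p)]sE.
  have sf : s (tofrac f) = tofrac f by rewrite sE; apply: phif.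
  rewrite -{1}sf -rmorphXn -rmorphM -[phiM p]/(phi p) pP sE.
  rewrite [LHS]Pp tofracM tofracXn.
  by rewrite mulrC.
have [a [b [b0 ->]]] := fractionP x.
by rewrite !fmorph_div !ss.
Qed.

(** * Values of rational functions at points *)

(** Two fractions for the same function agree after cross-multiplication. The conclusion is kept
    free of division because d may vanish at z. *)
Lemma has_value_fraction (R : realType) (n d : mpoly 8 (Cplx R)) z v :
  d != 0 -> has_value (rat_poly n / rat_poly d) z v ->
  meval z d * v = meval z n.
Proof.
move=> d0 [n' [d' [d'z /eqP + ->]]].
have d'0 : d' != 0 by apply: contraNneq d'z => ->; rewrite meval0.
rewrite /rat_poly eqr_div ?tofrac_eq0 // -!tofracM tofrac_eq => /eqP E.
have := congr1 (meval z) E; rewrite !mevalM => Ez.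
by rewrite mulrCA mulrA -Ez mulfK.
Qed.

Lemma has_value_poly (R : realType) (p : mpoly 8 (Cplx R)) z v :
  has_value (rat_poly p) z v -> v = meval z p.
Proof.
have -> : rat_poly p = rat_poly p / rat_poly 1.
  by rewrite [rat_poly 1]tofrac1 divr1.
move=> /has_value_fraction; rewrite meval1 mul1r; apply; exact: oner_neq0.
Qed.

(* sigma maps onto the hypersurface d = 0 and fixes its points.  As n does not
   vanish identically there, the denominator of any fraction equal to n / d
   does. *)
Lemma has_value_pole (R : realType) (n d : mpoly 8 (Cplx R)) z v
    (sigma : 8.-tuple (mpoly 8 (Cplx R))) :
  d != 0 -> comp_mpoly sigma d = 0 -> comp_mpoly sigma n != 0 ->
  (meval z d = 0 -> forall k, meval z (tnth sigma k) = z k) ->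
  has_value (rat_poly n / rat_poly d) z v -> meval z d != 0.
Proof.
move=> d0 sd sn sz [n' [d' [d'z /eqP + _]]].
have d'0 : d' != 0 by apply: contraNneq d'z => ->; rewrite meval0.
rewrite /rat_poly eqr_div ?tofrac_eq0 // -!tofracM tofrac_eq => /eqP E.
apply: contraNneq d'z => /sz zE; rewrite -(meval_eq d' zE) -comp_mpoly_meval.
have : comp_mpoly sigma (n * d') = 0.
  by rewrite E [LHS]rmorphM [X in _ * X]sd mulr0.
rewrite [LHS]rmorphM => /eqP; rewrite mulf_eq0 => /orP[/eqP sn0|/eqP sd'0].
  by rewrite [comp_mpoly sigma n]sn0 eqxx in sn.
by rewrite [X in meval z X]sd'0 meval0.
Qed.

(** * Coordinates, and phase-space involutions with poles along a hypersurface *)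

Local Notation wid := (widen_ord (isT : (4 <= 8)%N)).
Local Notation it1 := (@Ordinal 8 4 isT).
Local Notation it2 := (@Ordinal 8 5 isT).
Local Notation it3 := (@Ordinal 8 6 isT).
Local Notation ia0 := (@Ordinal 8 7 isT).

Lemma ord4_ind (P : 'I_4 -> Prop) : P iq1 -> P ip1 -> P iq2 -> P ip2 ->
  forall k, P k.
Proof.
by move=> ? ? ? ? [[|[|[|[|k]]]] lt_k] //; rewrite (bool_irrelevance lt_k isT).
Qed.

Lemma ord8_ind (P : 'I_8 -> Prop) : (forall k, P (wid k)) ->
  P it1 -> P it2 -> P it3 -> P ia0 -> forall k, P k.
Proof.
move=> P4 ? ? ? ? [k lt_k]; have [lt_k4|] := ltnP k 4.
  by rewrite (_ : Ordinal lt_k = wid (Ordinal lt_k4)) //; apply/val_inj.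
by case: k lt_k => [|[|[|[|[|[|[|[|k]]]]]]]] lt_k // _;
  rewrite (bool_irrelevance lt_k isT).
Qed.

Definition var (R : realType) (k : 'I_8) : mpoly 8 (Cplx R) :=
  mpolyX (Cplx R) (mnm1 k).

Lemma point_phase (R : realType) (v : 'I_4 -> Cplx R) (t : 'rV[Cplx R]_3) a0 k :
  Defs.point v t a0 (wid k) = v k.
Proof. by elim/ord4_ind: k. Qed.

Lemma point_alpha0 (R : realType) (v : 'I_4 -> Cplx R) (t : 'rV[Cplx R]_3) a0 :
  Defs.point v t a0 ia0 = a0.
Proof. by []. Qed.

Lemma mevalXn (R : realType) (n : nat) (z : 'I_n -> Cplx R) p e :
  meval z (p ^+ e) = meval z p ^+ e.
Proof. exact: (rmorphXn (meval z : {rmorphism mpoly n _ -> Cplx R})). Qed.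

Lemma mmap_var (R : realType) (g : 'I_8 -> ratfun R) k :
  mmap (tofrac \o @mpolyC 8 (Cplx R)) g (var R k) = g k.
Proof. by rewrite mmapX mmap1U. Qed.

Lemma comp_mpoly_var (R : realType) (lq : 8.-tuple (mpoly 8 (Cplx R))) k :
  comp_mpoly lq (var R k) = tnth lq k.
Proof. by rewrite comp_mpolyXU -tnth_nth. Qed.

(* x k is the image of the k-th phase variable, with numerator P k over f^2, and
   n / f is the image of p1, whose pole along f = 0 shows that a point where all
   the images have a value satisfies f != 0. *)
Section PhaseInvolution.
Variables (R : realType) (x : 'I_4 -> ratfun R).
Variables (f n : mpoly 8 (Cplx R)) (P : 'I_4 -> mpoly 8 (Cplx R)).
Hypothesis f_neq0 : f != 0.
Hypothesis xP : forall k, x k = rat_poly (P k) / rat_poly (f ^+ 2).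
(** Stated for every morphism with the prescribed images, so that checking it is pure ring
    calculus. *)
Hypothesis x_subst : forall phi : {rmorphism mpoly 8 (Cplx R) -> ratfun R},
  (forall k, phi (var R (wid k)) = x k) -> phi (var R ia0) = - Falpha0 R ->
  phi f = rat_poly f /\ forall k, phi (P k) = rat_poly f ^+ 2 * Fphase R k.

Lemma phase_involution :
  exists s : {rmorphism ratfun R -> ratfun R},
    [/\ s \o s =1 id, forall c, s (rat_const c) = rat_const c,
        [/\ s (Ft1 R) = Ft1 R, s (Ft2 R) = Ft2 R & s (Ft3 R) = Ft3 R],
        s (Falpha0 R) = - Falpha0 R & forall k, s (Fphase R k) = x k].
Proof.
pose g (k : 'I_8) := tnth [tuple x iq1; x ip1; x iq2; x ip2;
  Ft1 R; Ft2 R; Ft3 R; - Falpha0 R] k.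
have gx k : g (wid k) = x k by elim/ord4_ind: k.
pose phi : {rmorphism mpoly 8 (Cplx R) -> ratfun R} :=
  mmap (tofrac \o @mpolyC 8 (Cplx R)) g.
have phi_var k : phi (var R k) = g k by apply: mmap_var.
have [phif phiP] : phi f = rat_poly f /\
    forall k, phi (P k) = rat_poly f ^+ 2 * Fphase R k.
  by apply: x_subst => [k|]; rewrite phi_var.
have [|s [_ ss sc sX]] := involutive_substitution f_neq0 phif.
  have fixed k : g k = rat_var R k -> exists N Q,
      g k * tofrac f ^+ N = tofrac Q /\
      phi Q = tofrac (f ^+ N * mpolyX (Cplx R) (mnm1 k)).
    move=> gk; exists 0%N, (var R k); rewrite !expr0 mulr1 mul1r; split=> //.
    by rewrite phi_var.
  elim/ord8_ind => [k||||]; try exact: fixed.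
    (* Phase variables need the denominator f^2; the times and alpha0 have polynomial images and
       need none. *)
    exists 2%N, (P k); rewrite gx; split; last by rewrite phiP tofracM tofracXn.
    by rewrite xP /rat_poly tofracXn divfK // expf_neq0 // tofrac_eq0.
  exists 0%N, (- var R ia0); rewrite !expr0 mulr1 mul1r; split.
    by rewrite [RHS]tofracN.
  by rewrite rmorphN phi_var opprK.
exists s; split=> [//|//|||k].
- by split; apply: sX.
- exact: (sX ia0).
- by rewrite [LHS]sX gx.
Qed.

Hypothesis xp1 : x ip1 = rat_poly n / rat_poly f.
Hypothesis x_pole :
  forall psi : {rmorphism mpoly 8 (Cplx R) -> mpoly 8 (Cplx R)},
  psi (var R (wid iq1)) = var R (wid iq1) - f ->
  (forall k, k != wid iq1 -> psi (var R k) = var R k) ->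
  psi f = 0 /\ psi n != 0.

(** The substitution q1 -> q1 - f fixes every point of f = 0. By [x_pole] it kills f but not n, so
    p1 has a genuine pole at each such point. *)
Lemma phase_value z v : has_value (x ip1) z v -> meval z f != 0.
Proof.
pose sigma := [tuple if k == wid iq1 then var R k - f else var R k | k < 8].
have sE k : tnth sigma k = if k == wid iq1 then var R k - f else var R k.
  by rewrite tnth_mktuple.
pose psi : {rmorphism mpoly 8 (Cplx R) -> mpoly 8 (Cplx R)} := comp_mpoly sigma.
have psi_var k : psi (var R k) = tnth sigma k by apply: comp_mpoly_var.
have [psif psin] : psi f = 0 /\ psi n != 0.
  apply: x_pole => [|k /negPf k1]; first by rewrite psi_var sE eqxx.
  by rewrite psi_var sE k1.
rewrite xp1; apply: has_value_pole psif psin _ => //.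
move=> fz k; rewrite sE; case: eqP => [->|_]; last exact: mevalXU.
by rewrite mevalB fz subr0; apply: mevalXU.
Qed.

(** On the line alpha0 + alpha1 = 0 both parameter maps are negation, whence the single assumption
    on b. What remains is the differential statement, with the values of y given by f^2 y = P. *)
Lemma phase_Baecklund (b : Cplx R * Cplx R -> Cplx R * Cplx R) :
  (forall a0, b (a0, - a0) = (- a0, a0)) ->
  (forall a0 U y X, open U -> solution a0 (- a0) U X ->
    (forall t, U t -> let z := Defs.point (X ^~ t) t a0 in
       meval z f != 0 /\ forall k, meval z f ^+ 2 * y k t = meval z (P k)) ->
    solution (- a0) a0 U y) ->
  exists s : {rmorphism ratfun R -> ratfun R},
    [/\ Baecklund s b, s \o s =1 id,
        [/\ s (Ft1 R) = Ft1 R, s (Ft2 R) = Ft2 R & s (Ft3 R) = Ft3 R],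
        s (Falpha0 R) = - Falpha0 R & forall k, s (Fphase R k) = x k].
Proof.
move=> bE x_sol; have [s [ss sc st sa sx]] := phase_involution.
exists s; split; [|exact: ss|exact: st|exact: sa|exact: sx]; split.
- by exists s => r; apply: ss.
- exact: sc.
- exact: st.
- move=> a0 a1 v t c /eqP; rewrite addrC addr_eq0 => /eqP ->; rewrite bE.
  have sa1 : s (Falpha1 R) = Falpha0 R by rewrite rmorphN sa opprK.
  rewrite sa sa1 -[- Falpha0 R](tofracN (var R ia0)).
  split=> /has_value_poly ->.
    by rewrite mevalN; congr (- _); apply: mevalXU.
  exact: mevalXU.
- move=> a0 a1 U X y /eqP; rewrite addrC addr_eq0 => /eqP -> openU Xsol yX.
  rewrite bE /=; apply: x_sol openU Xsol _ => t Ut z.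
  have fz : meval z f != 0.
    by apply: (@phase_value _ (y ip1 t)); rewrite -sx; apply: yX.
  split=> // k; have := yX t k Ut; rewrite sx xP => /has_value_fraction.
  by rewrite mevalXn; apply; rewrite expf_neq0.
Qed.

End PhaseInvolution.

(** * Calculus of differentials *)

(** The first-order expansion at t only sees the germ of the function; uniqueness of the
    differential then identifies it. This is needed because y is given by a formula on U only. *)
Lemma is_diff_near (K : numFieldType) (V W : normedModType K) (f g df : V -> W)
    (t : V) :
  (\forall u \near t, f u = g u) -> is_diff t f df -> is_diff t g df.
Proof.
move=> fg [fdiff fdf].
have fgt : f t = g t by exact: nbhs_singleton fg.
have [dc] := (diff_locallyP t f).1 fdiff.
move/eqaddoP => fo.
have go : g \o shift t = cst (g t) + 'd f t +o_ 0 id.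
  apply/eqaddoP => e e0; have := fo e e0.
  have := fg; rewrite (near_shift 0) subr0 => fg'.
  move=> H; near=> h.
  have <- : f (h + t) - (f t + 'd f t h) =
      (g \o shift t - (cst (g t) + 'd f t)) h.
    rewrite !fctE /= fgt; congr (_ - _); near: h; exact: filterS fg'.
  near: h; exact: H.
have dg := diff_unique dc go.
split; first by apply/diff_locallyP; rewrite dg.
by rewrite dg.
Unshelve. all: by end_near. Qed.

Section IsDiffFun.
Variables (K : numFieldType) (V : normedModType K).
Implicit Types (f g df dg : V -> K) (t : V) (c : K).

Lemma is_diff_funD f g df dg t : is_diff t f df -> is_diff t g dg ->
  is_diff t (fun s => f s + g s) (fun h => df h + dg h).
Proof. exact: is_diffD. Qed.

Lemma is_diff_funB f g df dg t : is_diff t f df -> is_diff t g dg ->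
  is_diff t (fun s => f s - g s) (fun h => df h - dg h).
Proof. exact: is_diffB. Qed.

Lemma is_diff_funM f g df dg t : is_diff t f df -> is_diff t g dg ->
  is_diff t (fun s => f s * g s) (fun h => f t * dg h + g t * df h).
Proof. exact: is_diffM. Qed.

Lemma is_diff_funZ c f df t : is_diff t f df ->
  is_diff t (fun s => c * f s) (fun h => c * df h).
Proof. exact: is_diffZ. Qed.

Lemma is_diff_sqr f df t : is_diff t f df ->
  is_diff t (fun s => f s ^+ 2) (fun h => 2 * f t * df h).
Proof.
move=> dft; apply: is_diff_eq (is_diff_funM dft dft) _.
by apply/funext => h; ring.
Qed.

(** With u = c / f the differential reads -(u df / f), the shape of [du] in the velocity
    identities. *)
Lemma is_diff_cst_div c f df t : is_diff t f df -> f t != 0 ->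
  is_diff t (fun s => c / f s) (fun h => - (c / f t * df h / f t)).
Proof.
move=> [fdiff fdf] ft0.
have fVdiff := differentiableV fdiff ft0.
have dfV : is_diff t (fun s => (f s)^-1) (fun h => - f t ^- 2 * df h).
  by split=> //; rewrite diffV // fdf.
apply: is_diff_eq (is_diff_funZ c dfV) _.
by apply/funext => h; field.
Qed.

End IsDiffFun.

(** * Partial derivatives of the Hamiltonians *)

(** For e = 0 the predecessor is 0, and the multiplicity 0 makes the right-hand side vanish. *)
Lemma mderivXn (n : nat) (K : comNzRingType) (k : 'I_n) (p : mpoly n K) e :
  mderiv k (p ^+ e) = (p ^+ e.-1 * mderiv k p) *+ e.
Proof.
elim: e => [|e IHe]; first by rewrite expr0 mulr0n -mpolyC1 mderivC.
rewrite exprS mderivM IHe /=; case: e {IHe} => [|e] /=.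
  by rewrite expr0 mulr0n mulr0 addr0 mulr1 mul1r.
by rewrite mulrnAr mulrA -exprS [mderiv k p * _]mulrC -mulrS.
Qed.

Lemma mderiv_phase_var (R : realType) (k l : 'I_4) :
  mderiv k (phase_var R l) = mpolyC 4 (l == k)%:R.
Proof.
rewrite mderivX mnm1E; case: eqP => [->|_]; last by rewrite scale0r mpolyC0.
rewrite scale1r (_ : mnm_sub _ _ = mnm0) ?mpolyX0 //.
by apply/mnmP => i; rewrite mnmBE subnn mnm0E.
Qed.

Lemma meval_phase_var (R : realType) (v : 'I_4 -> Cplx R) (k : 'I_4) :
  meval v (phase_var R k) = v k.
Proof. exact: mevalXU. Qed.

(** Value and partial derivative are carried together, since the product rule needs both; the
    derivative is thus computed along the syntax of the polynomial. *)
Definition jet (R : realType) (k : 'I_4) (v : 'I_4 -> Cplx R)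
    (p : mpoly 4 (Cplx R)) (x d : Cplx R) :=
  meval v p = x /\ meval v (mderiv k p) = d.

Section Jet.
Variables (R : realType) (k : 'I_4) (v : 'I_4 -> Cplx R).
Implicit Types (p q : mpoly 4 (Cplx R)) (c x y d e : Cplx R).

Lemma jet_var l : jet k v (phase_var R l) (v l) (l == k)%:R.
Proof. by split; rewrite ?meval_phase_var // mderiv_phase_var mevalC. Qed.

Lemma jetD p q x y d e :
  jet k v p x d -> jet k v q y e -> jet k v (p + q) (x + y) (d + e).
Proof. by move=> [<- <-] [<- <-]; rewrite /jet mderivD !mevalD. Qed.

Lemma jetB p q x y d e :
  jet k v p x d -> jet k v q y e -> jet k v (p - q) (x - y) (d - e).
Proof. by move=> [<- <-] [<- <-]; rewrite /jet mderivB !mevalB. Qed.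

Lemma jetZ c p x d : jet k v p x d -> jet k v (c *: p) (c * x) (c * d).
Proof. by move=> [<- <-]; rewrite /jet mderivZ !mevalZ. Qed.

Lemma jetM p q x y d e :
  jet k v p x d -> jet k v q y e -> jet k v (p * q) (x * y) (d * y + x * e).
Proof. by move=> [<- <-] [<- <-]; rewrite /jet mderivM mevalD !mevalM. Qed.

Lemma jetXn p n x d :
  jet k v p x d -> jet k v (p ^+ n) (x ^+ n) (x ^+ n.-1 * d *+ n).
Proof.
by move=> [<- <-]; rewrite /jet mderivXn mevalMn mevalM !mevalXn.
Qed.

End Jet.

(** Differences are tried before sums, because p - q is itself a sum with an opposite. *)
Ltac jet :=
  lazymatch goal with
  | |- jet _ _ (phase_var _ _) _ _ => exact: jet_var
  | |- jet _ _ (_ ^+ _) _ _ => apply: jetXn; jet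
  | |- jet _ _ (_ *: _) _ _ => apply: jetZ; jet
  | |- jet _ _ (_ - _) _ _ => apply: jetB; jet
  | |- jet _ _ (_ + _) _ _ => apply: jetD; jet
  | |- jet _ _ (_ * _) _ _ => apply: jetM; jet
  end.

(** * Hamiltonian velocities at the original and the transformed point *)

(** The values and derivatives are free variables, to be filled in by [jet] once the Hamiltonians
    are unfolded. *)
Lemma ham_formE (R : realType) (a0 a1 : Cplx R) k v (h : 'rV[Cplx R]_3)
    x1 d1 x2 d2 x3 d3 :
  jet k v (K1 a0 a1) x1 d1 -> jet k v (K2 a0 a1) x2 d2 ->
  jet k v (K3 a0 a1) x3 d3 ->
  ham_form a0 a1 k v h =
  d1 * h 0 (inord 0) + d2 * h 0 (inord 1) + d3 * h 0 (inord 2).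
Proof.
move=> [_ <-] [_ <-] [_ <-].
rewrite /ham_form !big_ord_recl big_ord0 addr0 addrA.
by do ?congr (_ + _); congr (_ * h _ _); apply/ord_inj; rewrite [RHS]inordK.
Qed.

Ltac expand_ham_form :=
  erewrite ham_formE; [|rewrite /K1; jet|rewrite /K2; jet|rewrite /K3; jet].

(* The [change] is needed since [/=] turns the type of the equation into
   [complex R], on which [field] finds no structure. *)
Ltac velocity_field :=
  repeat expand_ham_form;
  repeat match goal with H : _ = _ |- _ => rewrite {}H end;
  rewrite /=;
  lazymatch goal with |- @eq _ ?a ?b => change (@eq (Cplx _) a b) end;
  field.

(* For u = alpha_i / f, the derivative du below comes from d(u f) = 0. *)
Section Velocity.
Variables (R : realType) (a0 u : Cplx R) (v w : 'I_4 -> Cplx R).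
Variable h : 'rV[Cplx R]_3.
Let dq1 := ham_form a0 (- a0) ip1 v h.
Let dp1 := - ham_form a0 (- a0) iq1 v h.
Let dq2 := ham_form a0 (- a0) ip2 v h.
Let dp2 := - ham_form a0 (- a0) iq2 v h.

(** The right-hand sides are the differentials of the transformed coordinates, expanded by the
    Leibniz rule; the left-hand sides are the velocities that the system with negated parameters
    prescribes there. *)
Lemma s0_velocity (f := v iq1 + v iq2 ^+ 2)
    (du := - (u * (dq1 + 2 * v iq2 * dq2) / f)) :
  f != 0 -> a0 = u * f ->
  w iq1 = v iq1 -> w ip1 = v ip1 - u ->
  w iq2 = v iq2 -> w ip2 = v ip2 - 2 * (u * v iq2) ->
  [/\ ham_form (- a0) a0 ip1 w h = dq1, - ham_form (- a0) a0 iq1 w h = dp1 - du,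
      ham_form (- a0) a0 ip2 w h = dq2
    & - ham_form (- a0) a0 iq2 w h = dp2 - 2 * (u * dq2 + v iq2 * du)].
Proof.
rewrite /du /dq1 /dq2 /dp1 /dp2 /f => f0 a0E w1 w2 w3 w4.
split; velocity_field => //.
Qed.

Lemma s1_velocity (f := v iq1 + v ip1 ^+ 2 + v ip2 ^+ 2)
    (du := - (u * (dq1 + 2 * v ip1 * dp1 + 2 * v ip2 * dp2) / f)) :
  f != 0 -> - a0 = u * f ->
  w iq1 = v iq1 + 2 * (u * v ip1) - u ^+ 2 -> w ip1 = v ip1 - u ->
  w iq2 = v iq2 + 2 * (u * v ip2) -> w ip2 = v ip2 ->
  [/\ ham_form (- a0) a0 ip1 w h =
        dq1 + 2 * (u * dp1 + v ip1 * du) - 2 * u * du,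
      - ham_form (- a0) a0 iq1 w h = dp1 - du,
      ham_form (- a0) a0 ip2 w h = dq2 + 2 * (u * dp2 + v ip2 * du)
    & - ham_form (- a0) a0 iq2 w h = dp2].
Proof.
(* Here alpha1 = -a0 = u f; solving for a0 lets it be eliminated by rewriting. *)
rewrite /du /dq1 /dq2 /dp1 /dp2 /f => f0 /(canRL (@opprK _)) a0E w1 w2 w3 w4.
split; velocity_field => //.
Qed.

End Velocity.

(** * Transformed solutions *)

Section Solutions.
Variables (R : realType) (a0 : Cplx R) (U : set 'rV[Cplx R]_3).
Variables x y : 'I_4 -> 'rV[Cplx R]_3 -> Cplx R.
Hypotheses (openU : open U) (xsol : solution a0 (- a0) U x).

Let is_diff_on t (g g' : 'rV[Cplx R]_3 -> Cplx R) dg dg' :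
  U t -> (forall s, U s -> g' s = g s) -> is_diff t g dg ->
  (forall h, dg' h = dg h) -> is_diff t g' dg'.
Proof.
move=> Ut gg' dgt dgg'; have <- : dg = dg' by apply/funext => h; rewrite dgg'.
apply: is_diff_near dgt; apply: filterS (open_nbhs_nbhs (conj openU Ut)).
by move=> s Us; rewrite gg'.
Qed.

Lemma s0_solution (f := fun t => x iq1 t + x iq2 t ^+ 2) :
  (forall t, U t -> f t != 0 /\
     [/\ y iq1 t = x iq1 t, y ip1 t = x ip1 t - a0 / f t,
         y iq2 t = x iq2 t & y ip2 t = x ip2 t - 2 * (a0 / f t * x iq2 t)]) ->
  solution (- a0) a0 U y.
Proof.
move=> yE t Ut; have [f0 [y1 y2 y3 y4]] := yE t Ut.
have [d1 d2 d3 d4] := xsol Ut.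
(* The parameter a0 is constant in t, so this is the differential of u = a0 / f. *)
have du := is_diff_cst_div a0 (is_diff_funD d1 (is_diff_sqr d3)) f0.
have a0E : a0 = a0 / f t * f t by rewrite divfK.
have v h := @s0_velocity R a0 (a0 / f t) (x ^~ t) (y ^~ t) h
  f0 a0E y1 y2 y3 y4.
split.
- apply: (is_diff_on Ut _ d1); first by move=> s /yE[_ []].
  by move=> h; have [e _ _ _] := v h; exact: e.
- apply: (is_diff_on Ut _ (is_diff_funB d2 du)); first by move=> s /yE[_ []].
  by move=> h; have [_ e _ _] := v h; exact: e.
- apply: (is_diff_on Ut _ d3); first by move=> s /yE[_ []].
  by move=> h; have [_ _ e _] := v h; exact: e.
- apply: (is_diff_on Ut _
    (is_diff_funB d4 (is_diff_funZ 2 (is_diff_funM du d3)))).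
    by move=> s /yE[_ []].
  by move=> h; have [_ _ _ e] := v h; exact: e.
Qed.

Lemma s1_solution (f := fun t => x iq1 t + x ip1 t ^+ 2 + x ip2 t ^+ 2) :
  (forall t, U t -> f t != 0 /\
     [/\ y iq1 t = x iq1 t + 2 * (- a0 / f t * x ip1 t) - (- a0 / f t) ^+ 2,
         y ip1 t = x ip1 t - (- a0 / f t),
         y iq2 t = x iq2 t + 2 * (- a0 / f t * x ip2 t) & y ip2 t = x ip2 t]) ->
  solution (- a0) a0 U y.
Proof.
move=> yE t Ut; have [f0 [y1 y2 y3 y4]] := yE t Ut.
have [d1 d2 d3 d4] := xsol Ut.
have du := is_diff_cst_div (- a0)
  (is_diff_funD (is_diff_funD d1 (is_diff_sqr d2)) (is_diff_sqr d4)) f0.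
have a0E : - a0 = - a0 / f t * f t by rewrite divfK.
have v h := @s1_velocity R a0 (- a0 / f t) (x ^~ t) (y ^~ t) h
  f0 a0E y1 y2 y3 y4.
split.
- apply: (is_diff_on Ut _ (is_diff_funB
    (is_diff_funD d1 (is_diff_funZ 2 (is_diff_funM du d2))) (is_diff_sqr du))).
    by move=> s /yE[_ []].
  by move=> h; have [e _ _ _] := v h; exact: e.
- apply: (is_diff_on Ut _ (is_diff_funB d2 du)); first by move=> s /yE[_ []].
  by move=> h; have [_ e _ _] := v h; exact: e.
- apply: (is_diff_on Ut _
    (is_diff_funD d3 (is_diff_funZ 2 (is_diff_funM du d4)))).
    by move=> s /yE[_ []].
  by move=> h; have [_ _ e _] := v h; exact: e.
- apply: (is_diff_on Ut _ d4); first by move=> s /yE[_ []].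
  by move=> h; have [_ _ _ e] := v h; exact: e.
Qed.

End Solutions.

(** * Rules for computing with rational functions and values *)

Section RatPoly.
Variable R : realType.
Implicit Types p q : mpoly 8 (Cplx R).

Lemma rat_polyD p q : rat_poly (p + q) = rat_poly p + rat_poly q.
Proof. exact: tofracD. Qed.

Lemma rat_polyN p : rat_poly (- p) = - rat_poly p.
Proof. exact: tofracN. Qed.

Lemma rat_polyM p q : rat_poly (p * q) = rat_poly p * rat_poly q.
Proof. exact: tofracM. Qed.

Lemma rat_polyXn p e : rat_poly (p ^+ e) = rat_poly p ^+ e.
Proof. exact: tofracXn. Qed.

Lemma rat_polyMn p e : rat_poly (p *+ e) = rat_poly p *+ e.
Proof. exact: tofracMn. Qed.

Lemma rat_poly_phase k : rat_poly (var R (wid k)) = Fphase R k.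
Proof. by []. Qed.

Lemma rat_poly_alpha0 : rat_poly (var R ia0) = Falpha0 R.
Proof. by []. Qed.

Lemma rat_poly_eq0 p : (rat_poly p == 0) = (p == 0).
Proof. exact: tofrac_eq0. Qed.

End RatPoly.

Definition rat_polyE := (rat_polyD, rat_polyN, rat_polyM, rat_polyXn,
  rat_polyMn, rat_poly_phase, rat_poly_alpha0).

Lemma meval_var (R : realType) (z : 'I_8 -> Cplx R) k : meval z (var R k) = z k.
Proof. exact: mevalXU. Qed.

Definition mevalE := (mevalD, mevalN, mevalM, mevalMn, mevalXn, meval_var).

Lemma meval_neq0 (R : realType) (z : 'I_8 -> Cplx R) p :
  meval z p != 0 -> p != 0.
Proof. by apply: contraNneq => ->; rewrite meval0. Qed.

Lemma var_neq0 (R : realType) k : var R k != 0.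
Proof. by apply: (@meval_neq0 _ (fun=> 1)); rewrite meval_var oner_neq0. Qed.

(** * The two generators *)

Section Reflections.
Variable R : realType.
Local Notation X k := (var R (wid k)).

(* [field] does not terminate on the concrete field of fractions, whose
   operations it unfolds: hence the generalization over the field. *)
Ltac ratfun_field :=
  repeat match goal with x := _ |- _ => subst x end;
  lazymatch goal with |- @eq _ ?a ?b => change (@eq (ratfun R) a b) end;
  rewrite /Falpha1 /Fq1 /Fp1 /Fq2 /Fp2;
  repeat match goal with H : is_true (_ != 0) |- _ => move: H end;
  move: (Fphase R iq1) (Fphase R ip1) (Fphase R iq2) (Fphase R ip2) (Falpha0 R);
  move: (ratfun R) => K *; by field.

Ltac Cplx_field :=
  lazymatch goal with |- @eq _ ?a ?b => change (@eq (Cplx R) a b) end; by field.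

Definition f0 : mpoly 8 (Cplx R) := X iq1 + X iq2 ^+ 2.

Lemma f0_neq0 : f0 != 0.
Proof.
(* At q1 = 1, with all other variables 0, the value is 1. *)
apply: (@meval_neq0 _ (fun k => (k == wid iq1)%:R)).
by rewrite /f0 !mevalE /= expr0n !addr0 oner_neq0.
Qed.

Lemma s0_exists : exists s : {rmorphism ratfun R -> ratfun R},
  [/\ s0_action s, Baecklund s (@s0_param R) & s \o s =1 id].
Proof.
pose F := Fq1 R + Fq2 R ^+ 2.
have FE : rat_poly f0 = F by rewrite /f0 !rat_polyE.
have F0 : F != 0 by rewrite -FE rat_poly_eq0 f0_neq0.
(* The nonvanishing of F is put in terms of the phase variables, so that it survives the
   generalization in [ratfun_field]. *)
rewrite /F /Fq1 /Fp1 /Fq2 /Fp2 in FE F0.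
pose x k := tnth [tuple Fq1 R; Fp1 R - Falpha0 R / F; Fq2 R;
                        Fp2 R - 2 * Falpha0 R * Fq2 R / F] k.
pose P k := tnth [tuple X iq1 * f0 ^+ 2; X ip1 * f0 ^+ 2 - var R ia0 * f0;
  X iq2 * f0 ^+ 2; X ip2 * f0 ^+ 2 - var R ia0 * X iq2 * f0 *+ 2] k.
have [||||||s [sB ss st sa sx]] := @phase_Baecklund R x f0
    (X ip1 * f0 - var R ia0) P f0_neq0 _ _ _ _ (@s0_param R).
- by elim/ord4_ind; rewrite /x /P /tnth /= !rat_polyE; ratfun_field.
- move=> phi phi_x phi_a.
  have phif : phi f0 = rat_poly f0.
    rewrite FE /f0 !rmorphD !rmorphXn !phi_x /x /tnth /=; ratfun_field.
  split=> //; rewrite FE.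
  elim/ord4_ind;
    rewrite /P /tnth /= !(rmorphD, rmorphN, rmorphM, rmorphXn, rmorphMn) /=;
    rewrite ?phi_a !phi_x /x /tnth /=; ratfun_field.
- by rewrite /x /tnth /= !rat_polyE; ratfun_field.
- move=> psi psi_q1 psi_var.
  have psif : psi f0 = 0.
    by rewrite /f0 !rmorphD !rmorphXn psi_q1 !psi_var // /f0; ring.
  (* Along f0 = 0 the numerator p1 f0 - alpha0 restricts to -alpha0, which is not identically
     zero. *)
  split=> //; rewrite rmorphB rmorphM psif mulr0 sub0r oppr_eq0 psi_var //.
  exact: var_neq0.
- by move=> a0; rewrite /s0_param /= mulr_natl mulr2n addKr.
- move=> a0 U y v openU vsol yP; apply: (s0_solution openU vsol) => t Ut.
  have [] := yP t Ut; set z := Defs.point _ _ _ => fz yk.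
  have fE : meval z f0 = v iq1 t + v iq2 t ^+ 2.
    by rewrite /f0 !mevalE /z !point_phase.
  rewrite fE in fz yk; split=> //.
  have yE k : y k t = meval z (P k) / (v iq1 t + v iq2 t ^+ 2) ^+ 2.
    by rewrite -yk mulrC mulKf // expf_neq0.
  split; rewrite yE /P /tnth /= !mevalE /z !point_phase ?point_alpha0;
    Cplx_field.
exists s; split=> //; split; [|exact: st|].
  by split; [exact: (sx iq1)|exact: (sx ip1)|exact: (sx iq2)|exact: (sx ip2)].
by rewrite [s (Falpha1 R)]rmorphN sa; split; ratfun_field.
Qed.

Definition f1 : mpoly 8 (Cplx R) := X iq1 + X ip1 ^+ 2 + X ip2 ^+ 2.

Lemma f1_neq0 : f1 != 0.
Proof.
apply: (@meval_neq0 _ (fun k => (k == wid iq1)%:R)).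
by rewrite /f1 !mevalE /= expr0n !addr0 oner_neq0.
Qed.

Lemma s1_exists : exists s : {rmorphism ratfun R -> ratfun R},
  [/\ s1_action s, Baecklund s (@s1_param R) & s \o s =1 id].
Proof.
pose F := Fq1 R + Fp1 R ^+ 2 + Fp2 R ^+ 2.
have FE : rat_poly f1 = F by rewrite /f1 !rat_polyE.
have F0 : F != 0 by rewrite -FE rat_poly_eq0 f1_neq0.
rewrite /F /Fq1 /Fp1 /Fq2 /Fp2 in FE F0.
pose x k := tnth [tuple
  Fq1 R + 2 * Falpha1 R * Fp1 R / F - Falpha1 R ^+ 2 / F ^+ 2;
  Fp1 R - Falpha1 R / F; Fq2 R + 2 * Falpha1 R * Fp2 R / F; Fp2 R] k.
(* The numerators over f1^2, with alpha1 replaced by -alpha0. *)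
pose P k := tnth [tuple
  X iq1 * f1 ^+ 2 - var R ia0 * X ip1 * f1 *+ 2 - var R ia0 ^+ 2;
  X ip1 * f1 ^+ 2 + var R ia0 * f1;
  X iq2 * f1 ^+ 2 - var R ia0 * X ip2 * f1 *+ 2; X ip2 * f1 ^+ 2] k.
have [||||||s [sB ss st sa sx]] := @phase_Baecklund R x f1
    (X ip1 * f1 + var R ia0) P f1_neq0 _ _ _ _ (@s1_param R).
- by elim/ord4_ind; rewrite /x /P /tnth /= !rat_polyE; ratfun_field.
- move=> phi phi_x phi_a.
  (* With u = alpha1 / f1, the term 2 u p1 - u^2 added to q1 cancels the change of p1^2 under p1 ->
     p1 - u, and p2 is fixed. *)
  have phif : phi f1 = rat_poly f1.
    rewrite FE /f1 !rmorphD !rmorphXn !phi_x /x /tnth /=; ratfun_field.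
  split=> //; rewrite FE.
  elim/ord4_ind;
    rewrite /P /tnth /= !(rmorphD, rmorphN, rmorphM, rmorphXn, rmorphMn) /=;
    rewrite ?phi_a !phi_x /x /tnth /=; ratfun_field.
- by rewrite /x /tnth /= !rat_polyE; ratfun_field.
- move=> psi psi_q1 psi_var.
  have psif : psi f1 = 0.
    by rewrite /f1 !rmorphD !rmorphXn psi_q1 !psi_var // /f1; ring.
  split=> //; rewrite rmorphD rmorphM psif mulr0 add0r psi_var //.
  exact: var_neq0.
- by move=> a0; rewrite /s1_param /= mulr_natl mulr2n opprK addrA subrr sub0r.
- move=> a0 U y v openU vsol yP; apply: (s1_solution openU vsol) => t Ut.
  have [] := yP t Ut; set z := Defs.point _ _ _ => fz yk.
  have fE : meval z f1 = v iq1 t + v ip1 t ^+ 2 + v ip2 t ^+ 2.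
    by rewrite /f1 !mevalE /z !point_phase.
  rewrite fE in fz yk; split=> //.
  have yE k : y k t =
      meval z (P k) / (v iq1 t + v ip1 t ^+ 2 + v ip2 t ^+ 2) ^+ 2.
    by rewrite -yk mulrC mulKf // expf_neq0.
  split; rewrite yE /P /tnth /= !mevalE /z !point_phase ?point_alpha0;
    Cplx_field.
exists s; split=> //; split; [|exact: st|].
  by split; [exact: (sx iq1)|exact: (sx ip1)|exact: (sx iq2)|exact: (sx ip2)].
by rewrite [s (Falpha1 R)]rmorphN sa; split; ratfun_field.
Qed.

End Reflections.

Theorem theorem4p4 (R : realType) :
  exists s0 s1 : {rmorphism ratfun R -> ratfun R},
    [/\ s0_action s0 /\ s1_action s1,
        Baecklund s0 (@s0_param R),
        Baecklund s1 (@s1_param R),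
        s0 \o s0 =1 id
      & s1 \o s1 =1 id].
Proof.
have [s0 [s0_act s0_B s0K]] := s0_exists R.
have [s1 [s1_act s1_B s1K]] := s1_exists R.
by exists s0, s1; split.
Qed.
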